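(* Let $t>2$ be a natural number, $n=2t+1$, and let $W=2^t+2+1$ be the Welch exponent, with $W^{-1}$ its inverse modulo $2^n-1$. Then $W^{-1}\pmod{2^n-1}$ is never congruent to $e(l,k)$ modulo $2^n-1$ for any natural number $l<n$ and any natural number $k$.
   Context: For natural numbers $l,k$, $e(l,k)=\sum_{j=0}^{l-1}2^{jk}$. *)

(* Defs.v *)
From mathcomp Require Export all_boot.
From mathcomp Require Import zify.

Definition e (l k : nat) : nat := \sum_(0 <= j < l) 2 ^ (j * k).

Definition welch (t : nat) : nat := 2 ^ t + 2 + 1.

(* w is a representative of the inverse of a modulo m; for coprime a and m the
   representatives form a single residue class modulo m. *)
Definition inverse_mod (m a w : nat) : Prop := a * w = 1 %[mod m].

(* The Welch exponent has an inverse for every t: with W := welch t and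
   N := 2 ^ (2 * t + 1) - 1, the gcd divides 17 as 2 * W ^ 2 + 17 = N + 12 * W,
   and 17 does not divide 2 ^ n - 1 for odd n. *)
Lemma welch_coprime (t : nat) : coprime (welch t) (2 ^ (2 * t + 1) - 1).
Proof.
set N := _ - 1.
have eqN : 2 * welch t ^ 2 + 17 = N + 12 * welch t.
  rewrite /N /welch expnD (mulnC 2 t) expnM -!mulnn.
  have := expn_gt0 2 t; set x := 2 ^ t => /= x0; nia.
have d17 : gcdn (welch t) N %| 17.
  rewrite -(@dvdn_addr (2 * welch t ^ 2)) ?eqN.
    by rewrite dvdn_add ?dvdn_gcdr // dvdn_mull ?dvdn_gcdl.
  by rewrite dvdn_mull // dvdn_exp // dvdn_gcdl.
case/primeP: (isT : prime 17) => _ /(_ _ d17) /orP[//|/eqP g17].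
have := dvdn_gcdr (welch t) N; rewrite g17 /N -eqn_mod_dvd ?expn_gt0 //.
have per u : 2 ^ (2 * u + 1) %% 17 \in [:: 2; 8; 15; 9].
  elim: u => [//|u IH]; rewrite mulnS -addnA expnD -modnMmr.
  by move: IH; rewrite !inE => /or4P[] /eqP->.
by move: (per t); rewrite !inE => /or4P[] /eqP->.
Qed.

(* Main.v *)
Require Import Defs.
From mathcomp Require Import zify.

(** Put [N = 2 ^ n - 1] and [W = 2 ^ t + 3].  As
    [(2 ^ k - 1) * e l k = 2 ^ (l * k) - 1], the congruence [W * e l k = 1]
    modulo [N] implies
      [2 ^ k + 2 ^ t + 2 = 2 ^ r + 2 ^ (r + 1) + 2 ^ (r + t)]  modulo [N],
    where [r = l * k] and all exponents may be reduced modulo [n].  After this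
    reduction both sides are smaller than [N], so they are equal integers, and
    uniqueness of binary expansions leaves only [k = r = 0] modulo [n].  In that
    case [e l k = l] modulo [N], and [1 < W * l < N] unless [l = 0]. *)

Lemma dvdn_sum_expn2 (a : nat) (s : seq nat) :
  path ltn a s -> 2 ^ a.+1 %| \sum_(i <- s) 2 ^ i.
Proof.
move=> /(order_path_min ltn_trans) /allP lt_a.
by rewrite big_seq; apply: dvdn_sum => i /lt_a; exact: dvdn_exp2l.
Qed.

(** The smallest exponent is the 2-adic valuation of the sum, since [2 ^ a.+1] divides every later
    term. Hence the heads agree, and they cancel. *)
Lemma sorted_sum_expn2_inj (s1 s2 : seq nat) :
  sorted ltn s1 -> sorted ltn s2 ->
  \sum_(i <- s1) 2 ^ i = \sum_(i <- s2) 2 ^ i -> s1 = s2.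
Proof.
have low_bit a b s s' : path ltn a s -> path ltn b s' ->
    2 ^ a + \sum_(i <- s) 2 ^ i = 2 ^ b + \sum_(i <- s') 2 ^ i -> b <= a.
  move=> /dvdn_sum_expn2 ps /dvdn_sum_expn2 ps' eq_sum.
  rewrite leqNgt; apply/negP => lt_ab.
  have: 2 ^ a.+1 %| 2 ^ a + \sum_(i <- s) 2 ^ i.
    rewrite eq_sum dvdn_add ?dvdn_exp2l //.
    by apply: dvdn_trans ps'; rewrite dvdn_exp2l // ltnW.
  by rewrite dvdn_addl // dvdn_Pexp2l // ltnn.
elim: s1 s2 => [|a s1 IH] [|b s2] //= ps1 ps2; rewrite ?big_nil ?big_cons.
- by move=> ?; have := expn_gt0 2 b; lia.
- by move=> ?; have := expn_gt0 2 a; lia.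
move=> eq_sum; have le_ba := low_bit _ _ _ _ ps1 ps2 eq_sum.
have le_ab := low_bit _ _ _ _ ps2 ps1 (esym eq_sum).
have eq_ab : a = b by lia.
rewrite -eq_ab in eq_sum *; congr (_ :: _).
by apply: IH (path_sorted ps1) (path_sorted ps2) (addnI eq_sum).
Qed.

Lemma expn2_mod (n m : nat) : 2 ^ m = 2 ^ (m %% n) %[mod 2 ^ n - 1].
Proof.
have one : 2 ^ n = 1 %[mod 2 ^ n - 1].
  by apply/eqP; rewrite eqn_mod_dvd ?expn_gt0.
rewrite {1}(divn_eq m n) expnD (mulnC _ n) expnM.
by rewrite -modnMml -modnXm one modnXm exp1n modnMml mul1n.
Qed.

(** Both subtractions of the geometric sum formula are moved across, to avoid truncation in
    [nat]. *)
Lemma e_geometric (l k : nat) : 2 ^ k * e l k + 1 = e l k + 2 ^ (l * k).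
Proof.
elim: l => [|l IH]; first by rewrite /e big_nil muln0.
have -> : e l.+1 k = e l k + 2 ^ (l * k) by rewrite /e big_nat_recr.
by rewrite mulSn expnD mulnDr; lia.
Qed.

Lemma e_modn_dvd (n l k : nat) : n %| k -> e l k = l %[mod 2 ^ n - 1].
Proof.
move=> n_k; elim: l => [|l IH]; first by rewrite /e big_nil.
have -> : e l.+1 k = e l k + 2 ^ (l * k) by rewrite /e big_nat_recr.
have /eqP n_lk : n %| l * k by rewrite dvdn_mull.
by rewrite -modnDm IH expn2_mod n_lk modnDm addn1.
Qed.

Lemma welch_mul_small (t l : nat) :
  2 < t -> l < 2 * t + 1 -> welch t * l < 2 ^ (2 * t + 1) - 1.
Proof.
move=> lt2t ltl.
have [x8 xt] : 8 <= 2 ^ t /\ 2 * t + 2 <= 2 ^ t.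
  elim: t lt2t {ltl} => // t IH; rewrite ltnS leq_eqVlt => /predU1P[<- //|/IH[]].
  by rewrite expnS; lia.
have -> : 2 ^ (2 * t + 1) = 2 * (2 ^ t * 2 ^ t).
  by rewrite -expnD -expnS addnn mul2n addn1.
(* With [x = 2 ^ t], the product is at most [(x + 3) * (x - 2) = x ^ 2 + x - 6], which is below
   [2 * x ^ 2 - 1]. *)
have lx : l <= 2 ^ t - 2 by lia.
by rewrite /welch; move: x8 lx; set x := 2 ^ t; nia.
Qed.

Lemma welch_exponents (t k r : nat) :
  let n := 2 * t + 1 in
  2 < t -> k < n -> r < n ->
  2 ^ k + 2 ^ t + 2 = 2 ^ r + 2 ^ ((r + 1) %% n) + 2 ^ ((r + t) %% n)
    %[mod 2 ^ n - 1] ->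
  k = 0.
Proof.
move=> n lt2t ltk ltr.
(* Sizes are measured in units of [2 ^ (n - 3)]: three distinct powers with exponents below [n] add
   up to at most [4 + 2 + 1 = 7] units, against 8 for [2 ^ n]. *)
have top : 2 ^ n = 8 * 2 ^ (n - 3) by rewrite -(expnD 2 3) /n; congr (2 ^ _); lia.
have top_ge : 16 <= 2 ^ (n - 3) by rewrite (@leq_pexp2l 2 4) // /n; lia.
have lek i : i < n -> 2 ^ i <= 4 * 2 ^ (n - 3).
  by move=> ?; rewrite -(expnD 2 2) leq_pexp2l //; lia.
have ltt : 2 ^ t <= 2 ^ (n - 3) by rewrite leq_pexp2l // /n; lia.
have sum3 a b c : a < b < c -> c < n -> 2 ^ a + 2 ^ b + 2 ^ c < 2 ^ n - 1.
  move=> /andP[ab bc] cn.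
  have a1 : 2 ^ a <= 2 ^ (n - 3) by rewrite leq_pexp2l //; lia.
  have b1 : 2 ^ b <= 2 * 2 ^ (n - 3) by rewrite -expnS leq_pexp2l //; lia.
  by have := lek _ cn; lia.
(* The three shapes of [s] record which exponents wrap around modulo [n]: none, only [r + t], or,
   for [r = 2 * t], both [r + 1] and [r + t]. *)
have [s [ss eqs lts cond]] : exists s, [/\ sorted ltn s,
    2 ^ r + 2 ^ ((r + 1) %% n) + 2 ^ ((r + t) %% n) = \sum_(i <- s) 2 ^ i,
    \sum_(i <- s) 2 ^ i < 2 ^ n - 1 &
    s = [:: r; r + 1; r + t] /\ r <= t \/
    s = [:: r - t.+1; r; r + 1] /\ t < r < 2 * t \/
    s = [:: 0; t.-1; 2 * t]].
  have sumE a b c : \sum_(i <- [:: a; b; c]) 2 ^ i = 2 ^ a + 2 ^ b + 2 ^ c.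
    by rewrite !big_cons big_nil addn0 addnA.
  have wrap m : n <= m < n + n -> m %% n = m - n.
    by move=> ?; rewrite -{1}(@subnK n m) ?modnDr ?modn_small; lia.
  have [rt|rt] := leqP r t.
    exists [:: r; r + 1; r + t]; rewrite sumE !modn_small ?sum3 /n; try lia.
    by split=> //=; [lia | left].
  have [r2t|r2t] := ltnP r (2 * t).
    exists [:: r - t.+1; r; r + 1]; rewrite sumE (wrap (r + t)) ?modn_small ?sum3 /n; try lia.
    split=> //=; [lia | | by right; left; split=> //; lia].
    have -> : r + t - (2 * t + 1) = r - t.+1 by lia.
    by lia.
  exists [:: 0; t.-1; 2 * t]; rewrite sumE !wrap ?sum3 /n; try lia.
  split=> //=; [lia | | by right; right].
  have -> : r = 2 * t by lia.
  have -> : 2 * t + 1 - (2 * t + 1) = 0 by lia.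
  have -> : 2 * t + t - (2 * t + 1) = t.-1 by lia.
  by lia.
rewrite eqs => eqm.
have {eqm eqs} : \sum_(i <- s) 2 ^ i = 2 ^ k + 2 ^ t + 2.
  by move: eqm; rewrite !modn_small //; have := lek _ ltk; lia.
have sum2 a b : a < b -> \sum_(i <- s) 2 ^ i = 2 ^ a + 2 ^ b -> s = [:: a; b].
  move=> ab sumE; apply: sorted_sum_expn2_inj; rewrite //= ?ab //.
  by rewrite !big_cons big_nil addn0.
have sum3' a b c : a < b < c ->
    \sum_(i <- s) 2 ^ i = 2 ^ a + 2 ^ b + 2 ^ c -> s = [:: a; b; c].
  move=> abc sumE; apply: sorted_sum_expn2_inj; rewrite //= ?andbT //.
  by rewrite !big_cons big_nil addn0 addnA.
have [-> //|k_gt0] := posnP k => sumE.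
(* For [k = 1] or [k = t] two equal powers merge and only two binary digits remain, whereas [s] has
   three entries. Otherwise the exponents 1, [k], [t] are distinct and fit none of the three
   shapes. *)
have [k1|k_gt1] := leqP k 1.
  have {}sumE : \sum_(i <- s) 2 ^ i = 2 ^ 2 + 2 ^ t.
    by rewrite sumE (_ : k = 1); lia.
  by case: cond => [[]|[[]|]]; rewrite (sum2 _ _ lt2t sumE).
have [kt|tk|kt] := ltngtP k t.
- have {}sumE : \sum_(i <- s) 2 ^ i = 2 ^ 1 + 2 ^ k + 2 ^ t by lia.
  have eqs : s = [:: 1; k; t] by apply: sum3' sumE; lia.
  by case: cond => [[]|[[]|]]; rewrite eqs => -[] *; lia.
- have {}sumE : \sum_(i <- s) 2 ^ i = 2 ^ 1 + 2 ^ t + 2 ^ k by lia.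
  have eqs : s = [:: 1; t; k] by apply: sum3' sumE; lia.
  by case: cond => [[]|[[]|]]; rewrite eqs => -[] *; lia.
have {}sumE : \sum_(i <- s) 2 ^ i = 2 ^ 1 + 2 ^ t.+1.
  by rewrite sumE kt (expnS 2 t); lia.
by case: cond => [[]|[[]|]]; rewrite (sum2 _ _ _ sumE) //; lia.
Qed.

Theorem theorem3 (t n : nat) (ht : 2 < t) (hn : n = 2 * t + 1)
    (w : nat) (hw : inverse_mod (2 ^ n - 1) (welch t) w)
    (l k : nat) (hl : l < n) :
  w <> e l k %[mod 2 ^ n - 1].
Proof.
move=> eqw; have {hw eqw} We1 : welch t * e l k = 1 %[mod 2 ^ n - 1].
  by rewrite -modnMmr -eqw modnMmr hw.
have n_gt0 : 0 < n by lia.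
suff n_k : n %| k.
  have := We1; rewrite -modnMmr e_modn_dvd // modnMmr hn.
  have lt_Wl : welch t * l < 2 ^ (2 * t + 1) - 1.
    by apply: welch_mul_small => //; rewrite -hn.
  case: (posnP l) lt_Wl => [-> _|l_gt0 lt_Wl].
    (* For [l = 0] the congruence reads [0 = 1], which fails because the modulus is at least 3. *)
    have := @leq_pexp2l 2 2 (2 * t + 1) isT; rewrite muln0 mod0n.
    by move=> ?; rewrite modn_small //; lia.
  rewrite !modn_small; [|by move: lt_Wl; rewrite /welch; nia|by []].
  by rewrite /welch; nia.
set r := l * k %% n.
apply/eqP; apply: (@welch_exponents t (k %% n) r); rewrite // -?hn ?ltn_mod //.
have shift m : 2 ^ (l * k + m) = 2 ^ ((r + m) %% n) %[mod 2 ^ n - 1].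
  by rewrite expn2_mod modnDml.
have red : 2 ^ (l * k) + 2 ^ (l * k + 1) + 2 ^ (l * k + t) =
    2 ^ r + 2 ^ ((r + 1) %% n) + 2 ^ ((r + t) %% n) %[mod 2 ^ n - 1].
  rewrite -modnDm -(modnDm (2 ^ (l * k))) !shift (expn2_mod n (l * k)) -/r.
  by rewrite modnDm -modnDml modnDm modnDml.
rewrite -red -addnA -modnDml -expn2_mod modnDml addnA.
(* After adding 1, the left side is [2 ^ k * 1 + W] and the right side [1 + W * 2 ^ (l * k)].
   Replacing each displayed 1 by [W * e l k] and factoring out [W] leaves [e_geometric]. *)
apply/eqP; rewrite -(eqn_modDr 1); apply/eqP.
have -> : 2 ^ k + 2 ^ t + 2 + 1 = 2 ^ k * 1 + welch t by rewrite /welch; lia.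
have -> : 2 ^ (l * k) + 2 ^ (l * k + 1) + 2 ^ (l * k + t) + 1
    = 1 + welch t * 2 ^ (l * k).
  by rewrite /welch !expnD; lia.
rewrite -modnDml -modnMmr -We1 modnMmr modnDml.
rewrite -(modnDml 1) -We1 modnDml -mulnDr -e_geometric.
by congr (_ %% _); lia.
Qed.
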